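(* Each $2$-permutational involutive birack is a $\pi$-isotope of a distributive involutive birack, for some bijection $\pi$. That is, for every $2$-permutational involutive birack $B$ on a set $X$ there exist a distributive involutive birack $D$ on $X$ and a bijection $\pi\colon X\to X$ such that $B$ is the $\pi$-isotope of $D$.
   Context: Algebras are non-empty. A left quasigroup is an algebra $(X,\circ,\backslash_\circ)$ with $x\circ(x\backslash_\circ y)=y=x\backslash_\circ(x\circ y)$ for all $x,y$; equivalently all left translations $L_x(a)=x\circ a$ are bijections, with $L_x^{-1}(a)=x\backslash_\circ a$. A right quasigroup is an algebra $(X,\bullet,/_\bullet)$ with $(y/_\bullet x)\bullet x=y=(y\bullet x)/_\bullet x$ for all $x,y$. A birack is an algebra $(X,\circ,\backslash_\circ,\bullet,/_\bullet)$ such that $(X,\circ,\backslash_\circ)$ is a left quasigroup, $(X,\bullet,/_\bullet)$ is a right quasigroup, and for all $x,y,z$: $x\circ(y\circ z)=(x\circ y)\circ((x\bullet y)\circ z)$; $(x\circ y)\bullet((x\bullet y)\circ z)=(x\bullet(y\circ z))\circ(y\bullet z)$; $(x\bullet y)\bullet z=(x\bullet(y\circ z))\bullet(y\bullet z)$. It is involutive if $(x\circ y)\circ(x\bullet y)=x$ and $(x\circ y)\bullet(x\bullet y)=y$ for all $x,y$. It is distributive if $x\circ(y\circ z)=(x\circ y)\circ(x\circ z)$ and $(y\bullet z)\bullet x=(y\bullet x)\bullet(z\bullet x)$ for all $x,y,z$. An involutive birack is $2$-permutational if $(z\circ x)\circ y=(t\circ x)\circ y$ for all $x,y,z,t$.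 A left quasigroup is right cyclic if $(x\backslash_\circ y)\backslash_\circ(x\backslash_\circ z)=(y\backslash_\circ x)\backslash_\circ(y\backslash_\circ z)$ for all $x,y,z$, and non-degenerate if $x\mapsto x\backslash_\circ x$ is a bijection. It is known that $(X,\circ,\backslash_\circ,\bullet,/_\bullet)$ is an involutive birack only if $(X,\circ,\backslash_\circ)$ is a non-degenerate right cyclic left quasigroup, and conversely each non-degenerate right cyclic left quasigroup $(X,\circ,\backslash_\circ)$ determines a unique involutive birack, with $x\bullet y=(x\circ y)\backslash_\circ x$. For a bijection $\pi$ of $X$, the $\pi$-isotope of a left quasigroup $(X,\circ,\backslash_\circ)$ is the left quasigroup $(X,\ast,\backslash_\ast)$ with $x\ast y=x\circ\pi(y)$ and $x\backslash_\ast y=\pi^{-1}(x\backslash_\circ y)$; it is non-degenerate if $(X,\circ,\backslash_\circ)$ is. If $(X,\circ,\backslash_\circ,\bullet,/_\bullet)$ is an involutive birack and the $\pi$-isotope $(X,\ast,\backslash_\ast)$ of $(X,\circ,\backslash_\circ)$ is right cyclic, the involutive birack $(X,\ast,\backslash_\ast,\diamond,/_\diamond)$ determined by $(X,\ast,\backslash_\ast)$ is called the $\pi$-isotope of $(X,\circ,\backslash_\circ,\bullet,/_\bullet)$; here $x\diamond y=\pi^{-1}(x\bullet\pi(y))$. *)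

(* Defs.v *)
From mathcomp Require Import ssreflect ssrfun ssrbool.

Set Implicit Arguments.
Unset Strict Implicit.
Unset Printing Implicit Defensive.

(* In the usual infix notation: lop x y is x \circ y, ldiv x y is
   x \backslash_\circ y, rop x y is x \bullet y and rdiv y x is y /_\bullet x;
   the dividend is the second argument of ldiv and the first one of rdiv. *)
Record left_quasigroup (X : Type) := LeftQuasigroup {
  lop : X -> X -> X;
  ldiv : X -> X -> X;
  lop_ldiv : forall x y, lop x (ldiv x y) = y;
  ldiv_lop : forall x y, ldiv x (lop x y) = y
}.

Record right_quasigroup (X : Type) := RightQuasigroup {
  rop : X -> X -> X;
  rdiv : X -> X -> X;
  rdiv_rop : forall x y, rop (rdiv y x) x = y;
  rop_rdiv : forall x y, rdiv (rop y x) x = y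
}.

Record birack (X : Type) := Birack {
  birack_left :> left_quasigroup X;
  birack_right :> right_quasigroup X;
  birack_lop : forall x y z,
    lop birack_left x (lop birack_left y z) =
    lop birack_left (lop birack_left x y)
      (lop birack_left (rop birack_right x y) z);
  birack_mix : forall x y z,
    rop birack_right (lop birack_left x y)
      (lop birack_left (rop birack_right x y) z) =
    lop birack_left (rop birack_right x (lop birack_left y z))
      (rop birack_right y z);
  birack_rop : forall x y z,
    rop birack_right (rop birack_right x y) z =
    rop birack_right (rop birack_right x (lop birack_left y z))
      (rop birack_right y z)
}.

Definition involutive_birack (X : Type) (B : birack X) : Prop :=
  forall x y, lop B (lop B x y) (rop B x y) = x /\
              rop B (lop B x y) (rop B x y) = y.

Definition distributive_birack (X : Type) (B : birack X) : Prop :=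
  (forall x y z, lop B x (lop B y z) = lop B (lop B x y) (lop B x z)) /\
  (forall x y z, rop B (rop B y z) x = rop B (rop B y x) (rop B z x)).

Definition two_permutational (X : Type) (B : birack X) : Prop :=
  forall x y z t, lop B (lop B z x) y = lop B (lop B t x) y.

Definition right_cyclic (X : Type) (Q : left_quasigroup X) : Prop :=
  forall x y z, ldiv Q (ldiv Q x y) (ldiv Q x z) =
                ldiv Q (ldiv Q y x) (ldiv Q y z).

Section Isotope.
Variables (X : Type) (Q : left_quasigroup X) (pi pi_inv : X -> X).
Hypotheses (piK : cancel pi pi_inv) (pi_invK : cancel pi_inv pi).

Let iso_op x y := lop Q x (pi y).
Let iso_div x y := pi_inv (ldiv Q x y).

Fact iso_op_div x y : iso_op x (iso_div x y) = y.
Proof. by rewrite /iso_op /iso_div pi_invK lop_ldiv. Qed.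

Fact iso_div_op x y : iso_div x (iso_op x y) = y.
Proof. by rewrite /iso_op /iso_div ldiv_lop piK. Qed.

Definition lq_isotope : left_quasigroup X :=
  LeftQuasigroup iso_op_div iso_div_op.

End Isotope.

(* Equality of left quasigroups is taken operation by operation.  The operation
   rdiv of B needs no clause: the right quasigroup laws determine it from rop. *)
Definition determined_by (X : Type) (Q : left_quasigroup X) (B : birack X) :
    Prop :=
  [/\ involutive_birack B,
      forall x y, lop B x y = lop Q x y,
      forall x y, ldiv B x y = ldiv Q x y &
      forall x y, rop B x y = ldiv Q (lop Q x y) x].

Definition is_isotope (X : Type) (B D : birack X) (pi pi_inv : X -> X)
    (piK : cancel pi pi_inv) (pi_invK : cancel pi_inv pi) : Prop :=
  right_cyclic (lq_isotope D piK pi_invK) /\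
  determined_by (lq_isotope D piK pi_invK) B.

(* Main.v *)
Require Import Defs.
From mathcomp Require Import ssreflect ssrfun ssrbool.

Set Implicit Arguments.
Unset Strict Implicit.
Unset Printing Implicit Defensive.

(** Write [L_x] for the left translations of the given birack [B].  In these
    terms 2-permutationality says that [L_(z o x)] depends on [x] alone.  The
    distributive birack sought is obtained by choosing a point [e] and replacing
    each [L_x] by [L_x L_e^-1], which amounts to forcing [e] to act trivially;
    [B] is then recovered as the isotope along [pi = L_e].

    The translations [K_x = L_x L_e^-1] have two properties.  They are
    reductive, [K_(K_x y) = K_y], since by 2-permutationality the left factor
    [x] may be exchanged for [e] ([trivialized_reductive]).
    They commute, which is the heart of the matter
    ([trivialized_commute]): the dual form of 2-permutationality says that [L_(z \ x) = N_x] depends on [x] alone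
    ([permutational_ldiv]), so the cyclic identity
    [L_x L_(x \ y) = L_y L_(y \ x)] becomes [L_x N_y = L_y N_x].  With [y = e]
    this gives [N_x = L_e^-1 L_x N_e], and substituting it back and cancelling
    [N_e] leaves [L_x L_e^-1 L_y = L_y L_e^-1 L_x].

    The dual form rests on non-degeneracy.  If [z o a = t o b] then
    2-permutationality makes [L_(u o a)] and [L_(v o b)] equal for all [u] and
    [v].  Fixed points [p = p o a] and [q = q o b] turn this into
    [L_p = L_q], and then the cyclic identity for [p] and [q] reduces to
    [L_a = L_b].

    Finally, commuting reductive translations always come from a distributive
    involutive birack, whose right translations are the inverses of the left
    ones ([reductive_birack]). *)

(** * Commuting reductive translations *)

Section Reductive.
Variables (X : Type) (Q : left_quasigroup X).
Hypothesis lop_reductive : forall x y z, lop Q (lop Q x y) z = lop Q y z.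
Hypothesis lop_commute :
  forall x y z, lop Q x (lop Q y z) = lop Q y (lop Q x z).

Lemma lop_ldiv_reductive x y z : lop Q (ldiv Q x y) z = lop Q y z.
Proof. by rewrite -(lop_reductive x) lop_ldiv. Qed.

Lemma ldiv_reductive x y z : ldiv Q (lop Q x y) z = ldiv Q y z.
Proof.
by rewrite -[in LHS](lop_ldiv Q y z) -(lop_reductive x y) ldiv_lop.
Qed.

Lemma ldiv_ldiv_reductive x y z : ldiv Q (ldiv Q x y) z = ldiv Q y z.
Proof. by rewrite -(ldiv_reductive x) lop_ldiv. Qed.

Lemma lop_ldiv_commute x y z : lop Q x (ldiv Q y z) = ldiv Q y (lop Q x z).
Proof. by rewrite -[in RHS](lop_ldiv Q y z) lop_commute ldiv_lop. Qed.

Lemma ldiv_commute x y z : ldiv Q x (ldiv Q y z) = ldiv Q y (ldiv Q x z).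
Proof. by rewrite -[in LHS](lop_ldiv Q x z) -lop_ldiv_commute ldiv_lop. Qed.

(** In the involutive birack determined by [Q], the right operation is
    [x * y = (x o y) \ x], which reductivity simplifies to [y \ x]. *)
Definition reductive_right : right_quasigroup X :=
  @RightQuasigroup X (fun x y => ldiv Q y x) (fun y x => lop Q x y)
    (ldiv_lop Q) (lop_ldiv Q).

Lemma reductive_birack_lop x y z :
  lop Q x (lop Q y z) =
  lop Q (lop Q x y) (lop Q (rop reductive_right x y) z).
Proof. by rewrite /= lop_reductive lop_ldiv_reductive lop_commute. Qed.

Lemma reductive_birack_mix x y z :
  rop reductive_right (lop Q x y) (lop Q (rop reductive_right x y) z) =
  lop Q (rop reductive_right x (lop Q y z)) (rop reductive_right y z).
Proof.
by rewrite /= ldiv_reductive lop_ldiv_reductive lop_ldiv_commute.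
Qed.

Lemma reductive_birack_rop x y z :
  rop reductive_right (rop reductive_right x y) z =
  rop reductive_right (rop reductive_right x (lop Q y z))
    (rop reductive_right y z).
Proof. by rewrite /= ldiv_reductive ldiv_ldiv_reductive ldiv_commute. Qed.

Definition reductive_birack : birack X :=
  Birack reductive_birack_lop reductive_birack_mix reductive_birack_rop.

Lemma reductive_birack_involutive : involutive_birack reductive_birack.
Proof.
move=> x y /=.
by rewrite lop_reductive lop_ldiv ldiv_ldiv_reductive ldiv_lop.
Qed.

Lemma reductive_birack_distributive : distributive_birack reductive_birack.
Proof.
split=> x y z /=; first by rewrite lop_reductive lop_commute.
by rewrite ldiv_ldiv_reductive ldiv_commute.
Qed.

End Reductive.

(** * Involutive biracks *)

Section Involutive.
Variables (X : Type) (B : birack X).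
Hypothesis B_inv : involutive_birack B.

Lemma involutive_rop x y : rop B x y = ldiv B (lop B x y) x.
Proof. by rewrite -{3}(proj1 (B_inv x y)) ldiv_lop. Qed.

(** The first birack law at [(x, x \ y)], where the right operation takes the
    value [y \ x]. *)
Lemma involutive_cyclic x y z :
  lop B x (lop B (ldiv B x y) z) = lop B y (lop B (ldiv B y x) z).
Proof. by rewrite birack_lop involutive_rop lop_ldiv. Qed.

Lemma involutive_right_cyclic : right_cyclic B.
Proof.
move=> x y z; set w := ldiv B (ldiv B x y) _.
have -> : z = lop B x (lop B (ldiv B x y) w) by rewrite !lop_ldiv.
by rewrite involutive_cyclic !ldiv_lop.
Qed.

(** Non-degeneracy, in the form that [x |-> x \ x] is onto.  The map
    [(x, y) |-> (x o y, x * y)] is an involution; it sends [(u / u, u)] to some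
    [(y, u)], and hence [(y, u)] back to [(u / u, u)].  As both pairs are sent
    to a pair ending in [u], right division gives [y = u / u]. *)
Lemma involutive_fixpoint u : exists p, lop B p u = p.
Proof.
exists (rdiv B u u); set p := rdiv B u u.
have pu : rop B p u = u by rewrite rdiv_rop.
have [_] := B_inv p u; rewrite pu => yu.
by rewrite -[LHS](rop_rdiv B u) yu.
Qed.

End Involutive.

(** * Trivializing one translation of a 2-permutational birack *)

Section Permutational.
Variables (X : Type) (B : birack X).
Hypotheses (B_inv : involutive_birack B) (B_2perm : two_permutational B).

Lemma permutational_ldiv z t x y :
  lop B (ldiv B z x) y = lop B (ldiv B t x) y.
Proof.
set a := ldiv B z x; set b := ldiv B t x.
have [p pa] := involutive_fixpoint B_inv a.
have [q qb] := involutive_fixpoint B_inv b.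
have Lpq w : lop B p w = lop B q w.
  by rewrite -pa -qb (B_2perm a w p z) (B_2perm b w q t) !lop_ldiv.
have divpq w : ldiv B p w = ldiv B q w.
  by rewrite -[in LHS](lop_ldiv B q w) -Lpq ldiv_lop.
have a_qp : a = ldiv B q p by rewrite -divpq -{2}pa ldiv_lop.
have b_pq : b = ldiv B p q by rewrite divpq -{2}qb ldiv_lop.
rewrite a_qp b_pq -[LHS](ldiv_lop B q) -(involutive_cyclic B_inv).
by rewrite Lpq ldiv_lop.
Qed.

Variable e : X.

(** The left quasigroup with translations [L_x L_e^-1], in which [e] acts as
    the identity. *)
Definition trivialized : left_quasigroup X :=
  lq_isotope B (lop_ldiv B e) (ldiv_lop B e).

Lemma trivialized_reductive x y z :
  lop trivialized (lop trivialized x y) z = lop trivialized y z.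
Proof. by rewrite /= (B_2perm _ _ x e) lop_ldiv. Qed.

Lemma trivialized_commute x y z :
  lop trivialized x (lop trivialized y z) =
  lop trivialized y (lop trivialized x z).
Proof.
rewrite /=.
(* This is N_w = L_e^-1 L_w N_e, with N_w written as L_(e \ w).  Below, e \ z
   is put in the form N_e v, which brings in the N_e to be cancelled. *)
have N w v : ldiv B e (lop B w (lop B (ldiv B e e) v)) =
             lop B (ldiv B e w) v.
  by rewrite (permutational_ldiv e w) (involutive_cyclic B_inv) ldiv_lop.
rewrite -(lop_ldiv B (ldiv B e e) (ldiv B e z)) !N.
rewrite (permutational_ldiv e x y) (involutive_cyclic B_inv).
by rewrite (permutational_ldiv y e x).
Qed.

End Permutational.

Theorem theorem6p12 (X : Type) (X_nonempty : inhabited X) (B : birack X)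
    (B_inv : involutive_birack B) (B_2perm : two_permutational B) :
  exists (D : birack X) (pi pi_inv : X -> X)
         (piK : cancel pi pi_inv) (pi_invK : cancel pi_inv pi),
    [/\ involutive_birack D, distributive_birack D & is_isotope B D piK pi_invK].
Proof.
have [e] := X_nonempty.
pose D := reductive_birack (trivialized_reductive B_2perm e)
                           (trivialized_commute B_inv B_2perm e).
exists D, (lop B e), (ldiv B e), (ldiv_lop B e), (lop_ldiv B e).
split; [exact: reductive_birack_involutive | exact: reductive_birack_distributive |].
have lopE x y : lop (lq_isotope D (ldiv_lop B e) (lop_ldiv B e)) x y = lop B x y.
  by rewrite /= ldiv_lop.
have ldivE x y :
    ldiv (lq_isotope D (ldiv_lop B e) (lop_ldiv B e)) x y = ldiv B x y.
  by rewrite /= ldiv_lop.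
split=> [x y z|]; first by rewrite !ldivE; exact: involutive_right_cyclic.
by split=> // x y; rewrite ldivE lopE; exact: involutive_rop.
Qed.
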